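(* Let $n,s\in\mathbb{N}$ and let $q_n=x_1^2+\dots+x_n^2$. The apolar ideal of the form $q_n^s$ is the ideal of $\mathbb{C}[y_1,\dots,y_n]$ generated by the harmonic polynomials of degree $s+1$: \[ (q_n^s)^{\perp}=\bigl(\mathcal{H}_n^{s+1}\bigr). \]
   Context: $\mathbb{N}$ denotes the natural numbers, and $n\in\mathbb{N}$ is the number of variables. Let $\mathcal{R}=\mathbb{C}[x_1,\dots,x_n]$ and $\mathcal{D}=\mathbb{C}[y_1,\dots,y_n]$ with their standard gradings. The apolarity action $\circ:\mathcal{D}\times\mathcal{R}\to\mathcal{R}$ is the bilinear action in which $y_i$ acts as $\partial/\partial x_i$ (so $\phi\circ f=\phi(\partial/\partial x_1,\dots,\partial/\partial x_n)f$). For a homogeneous $f\in\mathcal{R}$, its apolar ideal is $f^{\perp}=\{\phi\in\mathcal{D}:\phi\circ f=0\}$. The space $\mathcal{H}_n^d$ of $d$-harmonic polynomials is the space of homogeneous polynomials of degree $d$ in $n$ variables annihilated by the Laplace operator (the sum of the second partial derivatives with respect to each variable); here it is regarded as a subspace of $\mathcal{D}_d$, identifying $y_i$ with $x_i$, i.e. $\mathcal{H}_n^d=\{h\in\mathcal{D}_d:\sum_{i=1}^n\partial^2 h/\partial y_i^2=0\}$.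
   Formalization: The hypothesis ''n ≥ 2 or s = 0'' is added, since for n ≤ 1 and s ≥ 1 the claim is false: for n = 1 the apolar ideal of x^{2s} is (y^{2s+1}) while there are no nonzero harmonic forms of degree s+1, and for n = 0 the form is 0, with apolar ideal (1). *)

(* Defs.v *)
(* MathComp, with real_closed's [R[i]] as the complex numbers and multinomials'
   [{mpoly C[n]}] as C[x_1, ..., x_n]. *)
From mathcomp Require Import all_boot all_order all_algebra.
From mathcomp Require Import classical_sets reals.
From mathcomp.real_closed Require Import complex.
From mathcomp Require Import mpoly.

Set Implicit Arguments.
Unset Strict Implicit.
Unset Printing Implicit Defensive.

Import GRing.Theory.
Local Open Scope ring_scope.
Local Open Scope classical_set_scope.

(* phi o f = phi(d/dx_1, ..., d/dx_n) f: the monomial y^m acts as the iterated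
   partial derivative [f^`M[m]].  The rings of operators phi and of forms f are
   two copies of the same polynomial ring. *)
Definition apolar_action (C : comNzRingType) (n : nat)
    (phi f : {mpoly C[n]}) : {mpoly C[n]} :=
  \sum_(m <- msupp phi) phi@_m *: f^`M[m].

Definition apolar_ideal (C : comNzRingType) (n : nat) (f : {mpoly C[n]}) :
    set {mpoly C[n]} :=
  [set phi | apolar_action phi f = 0].

Definition laplacian (C : comNzRingType) (n : nat) (f : {mpoly C[n]}) :
    {mpoly C[n]} :=
  \sum_(i < n) f^`M(i)^`M(i).

(* In multinomials, 0 is homogeneous of every degree, so this is a space. *)
Definition harmonic (C : comNzRingType) (n d : nat) : set {mpoly C[n]} :=
  [set h | h \is d.-homog /\ laplacian h = 0].
Arguments harmonic : clear implicits.

Definition ideal_generated (A : comNzRingType) (S : set A) : set A :=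
  [set p | exists (k : nat) (a h : 'I_k -> A),
     (forall i, S (h i)) /\ p = \sum_(i < k) a i * h i].

Definition quadric (C : comNzRingType) (n : nat) : {mpoly C[n]} :=
  \sum_(i < n) 'X_i ^+ 2.
Arguments quadric : clear implicits.

(* Main.v *)
Require Import Defs.
From mathcomp Require Import all_boot all_order all_algebra.
From mathcomp Require Import classical_sets reals.
From mathcomp.real_closed Require Import complex.
From mathcomp Require Import mpoly ssrcomplements.
From mathcomp Require Import bigenough ring zify.

(** Write q for the quadric, H_k for the harmonic forms of degree k and I_k for
the ideal that they generate.  Over a field of characteristic 0, two
computations of derivatives carry everything:

- if h is in H_k, then h o q^m = 2^k m(m-1)...(m-k+1) q^(m-k) h
  ([apolar_action_harmonic]), by induction on k through Euler's identity;
- q o q^(s+1) = 2(s+1)(n+2s) q^s ([laplacian_quadricX]).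

For k = s+1 and m = s, the first formula vanishes, so I_(s+1) annihilates q^s.

The converse goes by induction on s.  By the second formula, an operator that
kills q^(s+1) also kills q^s, so it lies in I_(s+1) by induction; and
everything lies in I_0, which contains 1.  It remains to show, for every s, that
if p is in I_s and p o q^s = 0, then p is in I_(s+1).  The harmonic projection of
y_i h, for h in H_(k+1), is (n+2k) y_i h - q dh/dy_i up to a factor
([harmonic_varM]).  It has two consequences.  If n >= 2, then q H_k is contained
in I_(k+1) ([ideal_harmonic_quadricM]), hence q^j H_k in I_(k+j); for n = 1 this
breaks down, as H_k is zero for k >= 2.  And modulo
I_(s+1), multiplication by a variable maps q^j H_(s-j) to q^(j+1) H_(s-j-1).
So, modulo I_(s+1), each element of I_s is a sum of terms q^j h_j with h_j in
H_(s-j) ([expansion_of_ideal]).  By the two formulas, q^j h_j sends q^s to a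
nonzero multiple of h_j.  These values have pairwise distinct degrees s-j, so if
p o q^s = 0 then each h_j is zero and p is in I_(s+1)
([expansion_apolar]). *)

Set Implicit Arguments.
Unset Strict Implicit.
Unset Printing Implicit Defensive.

Import GRing.Theory BigEnough.

Local Open Scope ring_scope.
Local Open Scope classical_set_scope.

(** * The ideal generated by a set *)

Section Ideals.
Variables (A : comNzRingType) (S : set A).
Local Notation I := (ideal_generated S).

Lemma ideal_generated_ind (P : A -> Prop) :
  P 0 -> (forall p q, P p -> P q -> P (p + q)) ->
  (forall a h, S h -> P (a * h)) -> forall p, I p -> P p.
Proof.
move=> P0 PD PM p [k [a [h [Sh ->]]]].
by elim/big_ind: _ => // i _; apply: PM.
Qed.

Lemma ideal_generated0 : I 0.
Proof.
by exists 0, (fun=> 0), (fun=> 0); split=> [[]|] //; rewrite big_ord0.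
Qed.

Lemma ideal_generated_mem a h : S h -> I (a * h).
Proof. by move=> Sh; exists 1, (fun=> a), (fun=> h); rewrite big_ord1. Qed.

Lemma ideal_generatedD p q : I p -> I q -> I (p + q).
Proof.
move=> [k [a [h [Sh ->]]]] [l [b [g [Sg ->]]]].
exists (k + l)%N, (fun i => match split i with inl j => a j | inr j => b j end).
exists (fun i => match split i with inl j => h j | inr j => g j end).
split=> [i|]; first by case: (split i).
rewrite big_split_ord /=; congr (_ + _); apply: eq_bigr => i _.
  by rewrite (unsplitK (inl i)).
by rewrite (unsplitK (inr i)).
Qed.

Lemma ideal_generatedMl b p : I p -> I (b * p).
Proof.
move: p; apply: ideal_generated_ind => [|p q|a h Sh].
- by rewrite mulr0; apply: ideal_generated0.
- by rewrite mulrDr; apply: ideal_generatedD.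
- by rewrite mulrA; apply: ideal_generated_mem.
Qed.

Lemma ideal_generated_sum (J : Type) (r : seq J) (P : pred J) (G : J -> A) :
  (forall j, P j -> I (G j)) -> I (\sum_(j <- r | P j) G j).
Proof.
by move=> IG; elim/big_ind: _ => //;
  [apply: ideal_generated0 | apply: ideal_generatedD].
Qed.

End Ideals.

(** * The apolarity action *)

Section Apolarity.
Variables (C : comNzRingType) (n : nat).
Implicit Types (p q f g : {mpoly C[n]}) (i : 'I_n).

(** The support of p depends on p; summing over all monomials of bounded degree
makes the linearity in p visible. *)
Lemma apolar_action_bounded k p f : (msize p <= k)%N ->
  apolar_action p f = \sum_(m : 'X_{1..n < k}) p@_m *: f^`M[m].
Proof.
move=> pk; rewrite /apolar_action (big_mksub 'X_{1..n < k}) //=; first last.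
- by move=> x /msize_mdeg_lt /leq_trans; apply.
- exact: msupp_uniq.
rewrite big_rmcond //= => m.
by move=> /memN_msupp_eq0 ->; rewrite scale0r.
Qed.

Lemma apolar_actionD p q f :
  apolar_action (p + q) f = apolar_action p f + apolar_action q f.
Proof.
pose_big_enough k.
  rewrite !(@apolar_action_bounded k) // -big_split /=.
  by apply: eq_bigr => m _; rewrite mcoeffD scalerDl.
by close.
Qed.

Lemma apolar_actionZ c p f : apolar_action (c *: p) f = c *: apolar_action p f.
Proof.
pose_big_enough k.
  rewrite !(@apolar_action_bounded k) // scaler_sumr.
  by apply: eq_bigr => m _; rewrite mcoeffZ scalerA.
by close.
Qed.

Lemma apolar_action0 f : apolar_action 0 f = 0.
Proof. by rewrite /apolar_action msupp0 big_nil. Qed.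

Lemma apolar_action_sum (J : Type) (r : seq J) (P : pred J) G f :
  apolar_action (\sum_(j <- r | P j) G j) f =
  \sum_(j <- r | P j) apolar_action (G j) f.
Proof.
apply: (big_morph (fun p => apolar_action p f)).
- by move=> p q; apply: apolar_actionD.
- exact: apolar_action0.
Qed.

Lemma apolar_actionXm m f : apolar_action 'X_[m] f = f^`M[m].
Proof. by rewrite /apolar_action msuppX big_seq1 mcoeffX eqxx scale1r. Qed.

Lemma apolar_actionX i f : apolar_action 'X_i f = f^`M(i).
Proof. by rewrite apolar_actionXm mderivmU1m. Qed.

Lemma apolar_actionC c f : apolar_action c%:MP f = c *: f.
Proof.
rewrite -[c%:MP]mulr1 mul_mpolyC apolar_actionZ -mpolyX0.
by rewrite apolar_actionXm mderivm0m.
Qed.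

Lemma apolar_actionZr c p f : apolar_action p (c *: f) = c *: apolar_action p f.
Proof.
rewrite /apolar_action scaler_sumr; apply: eq_bigr => m _.
by rewrite mderivmZ !scalerA mulrC.
Qed.

Lemma apolar_action0r p : apolar_action p 0 = 0.
Proof. by rewrite /apolar_action big1 // => m _; rewrite raddf0 scaler0. Qed.

Lemma apolar_actionM p q f :
  apolar_action (p * q) f = apolar_action p (apolar_action q f).
Proof.
elim/mpolyind: p => [|c m p _ _ IHp]; first by rewrite mul0r !apolar_action0.
rewrite mulrDl !apolar_actionD IHp -scalerAl !apolar_actionZ.
congr (_ *: _ + _).
elim/mpolyind: q {IHp} => [|d l q _ _ IHq].
  by rewrite mulr0 apolar_action0 apolar_action0r.
rewrite mulrDr !apolar_actionD IHq -scalerAr !apolar_actionZ !apolar_actionXm.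
by rewrite mderivmD mderivmZ -mpolyXD apolar_actionXm addmC mderivmDm.
Qed.

Lemma apolar_action_quadric f : apolar_action (quadric C n) f = laplacian f.
Proof.
rewrite apolar_action_sum; apply: eq_bigr => i _.
by rewrite expr2 apolar_actionM !apolar_actionX.
Qed.

(** * The Laplacian, the quadric and harmonic forms *)

Lemma laplacianD p q : laplacian (p + q) = laplacian p + laplacian q.
Proof.
rewrite /laplacian -big_split /=.
by apply: eq_bigr => i _; rewrite !mderivD.
Qed.

Lemma laplacianZ c p : laplacian (c *: p) = c *: laplacian p.
Proof. by rewrite -!apolar_action_quadric apolar_actionZr. Qed.

Lemma laplacian_mderiv i p : laplacian p^`M(i) = (laplacian p)^`M(i).
Proof.
by rewrite -!apolar_action_quadric -!apolar_actionX -!apolar_actionM mulrC.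
Qed.

Lemma laplacianM p q :
  laplacian (p * q) =
  laplacian p * q + 2%:R *: (\sum_(i < n) p^`M(i) * q^`M(i)) + p * laplacian q.
Proof.
rewrite /laplacian mulr_suml mulr_sumr scaler_sumr -!big_split /=.
apply: eq_bigr => i _; rewrite mderivM mderivD !mderivM scaler_nat; ring.
Qed.

Lemma mderivXn k i p : (p ^+ k)^`M(i) = k%:R *: (p ^+ k.-1 * p^`M(i)).
Proof.
elim: k => [|k IHk]; first by rewrite expr0 -mpolyC1 mderivC scale0r.
rewrite exprS mderivM IHk !scaler_nat; case: k {IHk} => [|k] /=.
  by rewrite mulr0n mulr0 addr0 mulrC.
rewrite !exprS; ring.
Qed.

Lemma mderiv_var i j : ('X_j : {mpoly C[n]})^`M(i) = (i == j)%:R.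
Proof.
rewrite mderivX mnm1E eq_sym; case: eqP => [->|_]; last by rewrite scale0r.
by rewrite -{1}[U_(j)%MM]add0m addmK mpolyX0 scale1r.
Qed.

Lemma mderiv_quadric i : (quadric C n)^`M(i) = 2%:R *: 'X_i.
Proof.
rewrite raddf_sum (bigD1 i) //= big1 ?addr0 => [|j nji].
  by rewrite mderivXn mderiv_var eqxx mulr1.
by rewrite mderivXn mderiv_var eq_sym (negbTE nji) mulr0 scaler0.
Qed.

Lemma euler_identity d p : p \is d.-homog ->
  \sum_(i < n) 'X_i * p^`M(i) = d%:R *: p.
Proof.
move=> /dhomogP hp; rewrite {2}[p]mpolyE scaler_sumr.
transitivity (\sum_(i < n) \sum_(m <- msupp p)
  ((m i)%:R * p@_m) *: ('X_[m] : {mpoly C[n]})).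
  apply: eq_bigr => i _; rewrite {1}[p]mpolyE raddf_sum mulr_sumr /=.
  apply: eq_bigr => m _; rewrite mderivZ mderivX -!scalerAr scalerA mulrC.
  case: (posnP (m i)) => [->|mi_gt0]; first by rewrite !mul0r !scale0r.
  rewrite -mpolyXD addmC submK //; apply/mnm_lepP => j; rewrite mnm1E.
  by case: eqP => // <-.
rewrite exchange_big big_seq [RHS]big_seq /=; apply: eq_bigr => m /hp <-.
by rewrite -scaler_suml -mulr_suml -natr_sum -mdegE scalerA.
Qed.

Lemma mderiv_dhomog d i p : p \is d.-homog -> p^`M(i) \is d.-1.-homog.
Proof.
move=> hp; apply/dhomogP => m; rewrite mcoeff_msupp mcoeff_mderiv => nz.
have : (m + U_(i))%MM \in msupp p.
  by rewrite mcoeff_msupp; apply: contraNneq nz => ->; rewrite mul0rn.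
by move/(dhomogP _ _ _ hp) => <-; rewrite /= mdegD mdeg1 addn1.
Qed.

Lemma dhomog_var i : ('X_i : {mpoly C[n]}) \is 1.-homog.
Proof. by rewrite dhomogX /= mdeg1. Qed.

Lemma dhomog_quadric : quadric C n \is 2.-homog.
Proof.
by apply: rpred_sum => i _; rewrite -[2%N]mul1n; apply/dhomogMn/dhomog_var.
Qed.

Lemma dhomog0_const p : p \is 0.-homog -> p = (p@_0)%:MP.
Proof.
move=> hp; apply/mpolyP => m; rewrite mcoeffC eq_sym; case: eqP => [->|/eqP m0].
  by rewrite mulr1.
rewrite mulr0; apply: dhomog_nemf_coeff hp _.
by rewrite mdeg_eq0 eq_sym.
Qed.

Lemma harmonicD d p q :
  harmonic C n d p -> harmonic C n d q -> harmonic C n d (p + q).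
Proof.
move=> [hp lp] [hq lq]; split; first exact: dhomogD.
by rewrite laplacianD lp lq addr0.
Qed.

Lemma harmonicZ d c p : harmonic C n d p -> harmonic C n d (c *: p).
Proof.
move=> [hp lp]; split; first exact: dhomogZ.
by rewrite laplacianZ lp scaler0.
Qed.

Lemma harmonic_0 d : harmonic C n d 0.
Proof.
split; first exact: dhomog0.
by apply: big1 => i _; rewrite !raddf0.
Qed.

Lemma harmonic_const c : harmonic C n 0 c%:MP.
Proof.
split; first by rewrite -[c%:MP]mulr1 mul_mpolyC; apply/dhomogZ/dhomog1.
by apply: big1 => i _; rewrite mderivC raddf0.
Qed.

Lemma harmonic_var i : harmonic C n 1 'X_i.
Proof.
split; first exact: dhomog_var.
by apply: big1 => j _; rewrite mderiv_var -mpolyC_nat mderivC.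
Qed.

Lemma harmonic_mderiv d i h : harmonic C n d h -> harmonic C n d.-1 h^`M(i).
Proof.
move=> [hh lh]; split; first exact: mderiv_dhomog.
by rewrite laplacian_mderiv lh raddf0.
Qed.

Lemma laplacian_quadric : laplacian (quadric C n) = (2 * n)%:R.
Proof.
rewrite /laplacian.
under eq_bigr do rewrite mderiv_quadric mderivZ mderiv_var eqxx.
by rewrite sumr_const card_ord scaler_nat -mulrnA.
Qed.

Lemma sum_mderiv_quadric d h : h \is d.-homog ->
  \sum_(i < n) (quadric C n)^`M(i) * h^`M(i) = (2 * d)%:R *: h.
Proof.
move=> hh; under eq_bigr do rewrite mderiv_quadric -scalerAl.
by rewrite -scaler_sumr (euler_identity hh) scalerA natrM.
Qed.

Lemma laplacian_quadricM d h : harmonic C n d h ->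
  laplacian (quadric C n * h) = (2 * (n + 2 * d))%:R *: h.
Proof.
move=> [hh lh]; rewrite laplacianM laplacian_quadric lh mulr0 addr0.
rewrite (sum_mderiv_quadric hh) scalerA mulr_natl -scaler_nat -scalerDl.
congr (_ *: _); rewrite -natrM -natrD; congr _%:R; lia.
Qed.

(** In characteristic 0 and for n > 0, the factor is nonzero: each power of q is
obtained from the next one by an operator, so the apolar ideals of the powers of
q form a decreasing chain. *)
Lemma laplacian_quadricX s :
  laplacian (quadric C n ^+ s.+1) =
  (2 * s.+1 * (n + 2 * s))%:R *: quadric C n ^+ s.
Proof.
rewrite /laplacian; set q := quadric C n.
transitivity (\sum_(i < n) ((2 * s.+1)%:R *: q ^+ s
   + (2 * s.+1 * 2 * s)%:R *: (q ^+ s.-1 * 'X_i ^+ 2))).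
  apply: eq_bigr => i _; rewrite mderivXn /= mderivZ mderiv_quadric.
  rewrite mderivM mderivXn mderivZ mderiv_var eqxx mderiv_quadric !scaler_nat.
  rewrite -[true%:R]/(1%:R); move: (q ^+ s.-1) (q ^+ s) => u v; ring.
rewrite big_split sumr_const card_ord -scaler_sumr -mulr_sumr.
rewrite -[\sum_(i < n) _]/q /=.
rewrite -exprSr !scaler_nat; case: s => [|s] /=; last by ring.
by rewrite !muln0 mulr0n; ring.
Qed.

(** Up to a factor, this is the harmonic projection of 'X_i * h: the Laplacian
of 'X_i * h is twice the i-th derivative of h, and by [laplacian_quadricM] that of
q times this derivative is 2(n + 2d) times it. *)
Lemma harmonic_varM d i h : harmonic C n d.+1 h ->
  harmonic C n d.+2 ((n + 2 * d)%:R *: ('X_i * h) - quadric C n * h^`M(i)).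
Proof.
move=> Hh; have [hh lh] := Hh; have Hhi := harmonic_mderiv i Hh; split.
  apply: rpredB.
    by apply/dhomogZ/(dhomogM (dhomog_var i) hh).
  by apply: (dhomogM dhomog_quadric (mderiv_dhomog i hh)).
rewrite -scaleN1r laplacianD !laplacianZ (laplacian_quadricM Hhi) /=.
rewrite laplacianM lh.
have [_ ->] := harmonic_var i.
rewrite (bigD1 i) //= big1 ?mderiv_var ?eqxx => [|j nji]; last first.
  by rewrite mderiv_var (negbTE nji) mul0r.
rewrite !scaler_nat scaleN1r -[true%:R]/(1%:R); ring.
Qed.

End Apolarity.

(** * Harmonic ideals in characteristic 0 *)

Section CharZero.
Variables (F : fieldType) (n : nat).
Hypothesis F0 : [pchar F] =i pred0.
Local Notation q := (quadric F n).
Local Notation H := (harmonic F n).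
Local Notation I d := (ideal_generated (H d)).
Implicit Types (p h : {mpoly F[n]}).

Lemma natf_neq0_gt0 k : (0 < k)%N -> k%:R != 0 :> F.
Proof. by rewrite ((pcharf0P F).1 F0) lt0n. Qed.

Lemma scale_nat_inj k p p' : (0 < k)%N -> k%:R *: p = k%:R *: p' -> p = p'.
Proof.
move=> k0 /(congr1 ( *:%R k%:R^-1)).
by rewrite !scalerA mulVf ?natf_neq0_gt0 ?scale1r.
Qed.

(** By Euler's identity, k+1 times h is the sum of the 'X_i * h_i, where the
derivatives h_i are harmonic of degree k.  Inductively, h_i sends q^m to a
multiple of q^(m-k) h_i; differentiating along i and summing over i, the
Laplacian of h disappears and Euler's identity restores h. *)
Lemma apolar_action_harmonic k m h : H k h ->
  apolar_action h (q ^+ m) = (2 ^ k * m ^_ k)%:R *: (q ^+ (m - k) * h).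
Proof.
elim: k h => [|k IHk] h Hh; have [hh lh] := Hh.
  rewrite (dhomog0_const hh) apolar_actionC ffactn0 scale1r subn0.
  by rewrite mulrC mul_mpolyC.
apply: (@scale_nat_inj k.+1) => //.
rewrite -apolar_actionZ -(euler_identity hh) apolar_action_sum.
transitivity ((2 ^ k * m ^_ k)%:R *: (\sum_(i < n)
   ((2 * (m - k))%:R *: (q ^+ (m - k.+1) * ('X_i * h^`M(i)))
    + q ^+ (m - k) * h^`M(i)^`M(i)))).
  rewrite scaler_sumr; apply: eq_bigr => i _.
  rewrite apolar_actionM (IHk _ (harmonic_mderiv i Hh)) apolar_actionX mderivZ.
  rewrite mderivM mderivXn mderiv_quadric -subnS; congr (_ *: (_ + _)).
  by rewrite !scaler_nat; ring.
rewrite big_split /= -scaler_sumr -!mulr_sumr -/(laplacian h) lh mulr0 addr0.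
rewrite (euler_identity hh) -scalerAr !scalerA -!natrM ffactnSr expnS.
by congr (_%:R *: _); ring.
Qed.

(** Multiplying the harmonic forms g_i of [harmonic_varM] by 'X_i and summing
over i gives, by Euler's identity, a nonzero multiple of q * h if the degree of
h is positive.  For h constant, the variables themselves are harmonic. *)
Lemma ideal_harmonic_quadricM k p : (2 <= n)%N -> I k p -> I k.+1 (q * p).
Proof.
move=> n2; move: p; apply: ideal_generated_ind => [|p p'|a h Hh].
- by rewrite mulr0; apply: ideal_generated0.
- by rewrite mulrDr; apply: ideal_generatedD.
rewrite mulrCA; apply: ideal_generatedMl; have [hh _] := Hh.
case: k => [|k] in Hh hh *.
  rewrite (dhomog0_const hh) mulrC; apply: ideal_generatedMl.
  apply: ideal_generated_sum => i _; rewrite expr2; apply: ideal_generated_mem.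
  exact: harmonic_var.
have nk0 : (0 < n + k - 1)%N by lia.
(* n + k - 1 = (n + 2k) - (k + 1), where k + 1 is the degree of h. *)
have -> : q * h = (n + k - 1)%:R^-1%:MP *
    \sum_(i < n) 'X_i * ((n + 2 * k)%:R *: ('X_i * h) - q * h^`M(i)).
  apply: (@scale_nat_inj (n + k - 1)) => //.
  rewrite mul_mpolyC scalerA mulfV ?natf_neq0_gt0 // scale1r.
  transitivity ((n + 2 * k)%:R *: (q * h) - q * (\sum_(i < n) 'X_i * h^`M(i))).
    rewrite (euler_identity hh) -scalerAr -scalerBl.
    rewrite -natrB; last by lia.
    by congr (_%:R *: _); lia.
  rewrite mulr_suml mulr_sumr scaler_sumr -sumrB; apply: eq_bigr => i _.
  by rewrite !scaler_nat; ring.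
apply/ideal_generatedMl/ideal_generated_sum => i _.
by apply: ideal_generated_mem; apply: harmonic_varM.
Qed.

Lemma ideal_harmonic_quadricXM j k p :
  (2 <= n)%N \/ j = 0%N -> I k p -> I (k + j) (q ^+ j * p).
Proof.
case=> [n2|->] Ip; last by rewrite addn0 expr0 mul1r.
elim: j => [|j IHj]; first by rewrite addn0 expr0 mul1r.
by rewrite addnS exprS -mulrA; apply: ideal_harmonic_quadricM.
Qed.

Lemma ideal_harmonic_apolar s p : I s.+1 p -> apolar_action p (q ^+ s) = 0.
Proof.
move: p; apply: ideal_generated_ind => [|p p' Ap Ap'|a h Hh].
- exact: apolar_action0.
- by rewrite apolar_actionD Ap Ap' addr0.
- rewrite apolar_actionM (apolar_action_harmonic _ Hh) ffact_small //.
  by rewrite muln0 scale0r apolar_action0r.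
Qed.

(** * Harmonic expansions modulo the ideal of H_(s+1) *)

(** The degrees s + j of the terms q^j h_j are pairwise distinct, so the sum
vanishes only if all its terms do. *)
Definition harmonic_expansion s p := exists2 h : nat -> {mpoly F[n]},
  (forall j, H (s - j) (h j)) & I s.+1 (p - \sum_(j < s.+1) q ^+ j * h j).

Section Expansion.
Variable s : nat.
Hypothesis hns : (2 <= n)%N \/ s = 0%N.

Lemma expansion_of_idealS p : I s.+1 p -> harmonic_expansion s p.
Proof.
move=> Ip; exists (fun=> 0) => [j|]; first exact: harmonic_0.
by rewrite big1 ?subr0 // => j _; rewrite mulr0.
Qed.

Lemma expansionD p p' :
  harmonic_expansion s p -> harmonic_expansion s p' ->
  harmonic_expansion s (p + p').
Proof.
move=> [h Hh Ip] [h' Hh' Ip']; exists (fun j => h j + h' j).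
  by move=> j; apply: harmonicD.
under eq_bigr do rewrite mulrDr.
by rewrite big_split opprD addrACA; apply: ideal_generatedD.
Qed.

Lemma expansion_term j h :
  (j <= s)%N -> H (s - j) h -> harmonic_expansion s (q ^+ j * h).
Proof.
move=> js Hh; exists (fun l => if l == j then h else 0).
  by move=> l; case: eqP => [->|_] //; apply: harmonic_0.
rewrite (bigD1 (Ordinal (js : (j < s.+1)%N))) //= eqxx big1 => [|l].
  by rewrite addr0 subrr; apply: ideal_generated0.
by rewrite -val_eqE /= => /negbTE ->; rewrite mulr0.
Qed.

Lemma expansionZ c p : harmonic_expansion s p -> harmonic_expansion s (c *: p).
Proof.
move=> [h Hh Ip]; exists (fun j => c *: h j).
  by move=> j; apply: harmonicZ.
under eq_bigr do rewrite -scalerAr.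
by rewrite -scaler_sumr -scalerBr -mul_mpolyC; apply: ideal_generatedMl.
Qed.

(** By [harmonic_varM], 'X_i maps q^j H_(s-j) into the sum of q^j H_(s-j+1),
which lies in the ideal of H_(s+1), and q^(j+1) H_(s-j-1), the next summand.
For j = s there is no next summand: constants are multiplied into H_1. *)
Lemma expansion_varM i p :
  harmonic_expansion s p -> harmonic_expansion s ('X_i * p).
Proof.
move=> [h Hh Ip]; rewrite -[p](subrK (\sum_(j < s.+1) q ^+ j * h j)) mulrDr.
apply: expansionD.
  by apply/expansion_of_idealS/ideal_generatedMl.
rewrite mulr_sumr; elim/big_ind: _ => [|u v|j _].
- by apply/expansion_of_idealS/ideal_generated0.
- exact: expansionD.
have js : (j <= s)%N by rewrite -ltnS.
have hnj : (2 <= n)%N \/ j = 0%N :> nat by case: hns; [left | right; lia].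
have Ij k g : (k + j = s.+1)%N -> H k g -> I s.+1 (q ^+ j * g).
  move=> kj Hg; have := @ideal_harmonic_quadricXM j k g hnj; rewrite kj; apply.
  by rewrite -[g]mul1r; apply: ideal_generated_mem.
rewrite mulrCA; move: (Hh j); case Esj: (s - j)%N => [|k] Hhj.
  have [hh _] := Hhj; apply/expansion_of_idealS/(Ij 1%N); first by lia.
  by rewrite (dhomog0_const hh) mulrC mul_mpolyC; apply/harmonicZ/harmonic_var.
have n2 : (2 <= n)%N by case: hns => // s0; lia.
have -> : q ^+ j * ('X_i * h j) = (n + 2 * k)%:R^-1 *:
    (q ^+ j * ((n + 2 * k)%:R *: ('X_i * h j) - q * (h j)^`M(i))
     + q ^+ j.+1 * (h j)^`M(i)).
  have nk0 : (0 < n + 2 * k)%N by lia.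
  apply: (scale_nat_inj nk0).
  rewrite scalerA mulfV ?natf_neq0_gt0 // scale1r.
  by rewrite exprSr !scaler_nat; ring.
apply/expansionZ/expansionD.
  by apply/expansion_of_idealS/(Ij k.+2); [lia | apply: harmonic_varM].
apply: expansion_term; first by lia.
have -> : (s - j.+1 = k)%N by lia.
exact: harmonic_mderiv Hhj.
Qed.

Lemma expansionMl a p : harmonic_expansion s p -> harmonic_expansion s (a * p).
Proof.
move=> sp; elim/mpolyind: a => [|c m a _ _ IHa].
  by rewrite mul0r; apply/expansion_of_idealS/ideal_generated0.
rewrite mulrDl -scalerAl; apply/expansionD/IHa/expansionZ.
rewrite mpolyXE_id; elim/big_ind: _ p {a IHa} sp => [p|u v IHu IHv p|i _ p] sp.
- by rewrite mul1r.
- by rewrite -mulrA; apply/IHu/IHv.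
elim: (m i) => [|k IHk]; first by rewrite mul1r.
by rewrite exprS -mulrA; apply: expansion_varM.
Qed.

Lemma expansion_of_ideal p : I s p -> harmonic_expansion s p.
Proof.
move: p; apply: ideal_generated_ind => [|p p'|a h Hh].
- by apply/expansion_of_idealS/ideal_generated0.
- exact: expansionD.
- apply: expansionMl; rewrite -[h]mul1r -(expr0 q).
  by apply: expansion_term; rewrite ?subn0.
Qed.

Lemma apolar_action_quadricX j : (j <= s)%N -> exists2 c : nat,
  (0 < c)%N & apolar_action (q ^+ j) (q ^+ s) = c%:R *: q ^+ (s - j).
Proof.
elim: j => [|j IHj] js.
  by exists 1%N; rewrite // expr0 subn0 -mpolyC1 apolar_actionC.
have [c c0 Ec] := IHj (ltnW js).
have n2 : (2 <= n)%N by case: hns => // s0; lia.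
exists (c * (2 * (s - j) * (n + 2 * (s - j.+1))))%N.
  by rewrite !muln_gt0 c0 subn_gt0 js addn_gt0 (ltnW n2).
rewrite exprS apolar_actionM Ec apolar_actionZr apolar_action_quadric.
have -> : (s - j = (s - j.+1).+1)%N by lia.
by rewrite laplacian_quadricX scalerA -natrM.
Qed.

(** The first factor takes q^s to a multiple of q^(s-j), and by
[apolar_action_harmonic] h, being of degree s-j, takes this to a multiple of
q^0 * h. *)
Lemma apolar_action_quadricXM_harmonic j h : (j <= s)%N -> H (s - j) h ->
  exists2 c : nat,
    (0 < c)%N & apolar_action (q ^+ j * h) (q ^+ s) = c%:R *: h.
Proof.
move=> js Hh; have [c c0 Ec] := apolar_action_quadricX js.
exists (c * (2 ^ (s - j) * (s - j) ^_ (s - j)))%N.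
  by rewrite !muln_gt0 c0 expn_gt0 ffact_gt0 leqnn.
rewrite mulrC apolar_actionM Ec apolar_actionZr (apolar_action_harmonic _ Hh).
by rewrite subnn expr0 mul1r scalerA -natrM.
Qed.

(** By [apolar_action_quadricXM_harmonic], the homogeneous components of p o q^s
are nonzero multiples of the h_j, so all the h_j vanish. *)
Lemma expansion_apolar p :
  harmonic_expansion s p -> apolar_action p (q ^+ s) = 0 -> I s.+1 p.
Proof.
move=> [h Hh Ip] Ap; suff h0 : forall j : 'I_s.+1, h j = 0.
  rewrite -[p]subr0; congr (I s.+1 (p - _)): Ip.
  by apply: big1 => j _; rewrite h0 mulr0.
have sum0 : \sum_(j < s.+1) apolar_action (q ^+ j * h j) (q ^+ s) = 0.
  rewrite -apolar_action_sum; have := ideal_harmonic_apolar Ip.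
  rewrite -scaleN1r apolar_actionD apolar_actionZ Ap add0r scaleN1r => /eqP.
  by rewrite oppr_eq0 => /eqP.
move=> j; have js : (j <= s)%N by rewrite -ltnS.
have [c c0 Ec] := apolar_action_quadricXM_harmonic js (Hh j).
apply: (scale_nat_inj c0); rewrite scaler0 -Ec.
have {sum0} := congr1 (pihomog mdeg (s - j)) sum0.
rewrite raddf_sum raddf0 (bigD1 j) //= big1 => [|l nlj].
  rewrite addr0 Ec pihomog_dE //; apply: dhomogZ.
  by have [] := Hh j.
have ls : (l <= s)%N by rewrite -ltnS.
have [d _ ->] := apolar_action_quadricXM_harmonic ls (Hh l).
apply: (@pihomog_ne0 _ _ _ (s - l)%N).
  by move: nlj; apply: contraNneq => E; apply/eqP/val_inj => /=; lia.
by apply: dhomogZ; have [] := Hh l.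
Qed.
End Expansion.

Lemma apolar_ideal_quadricX s : (2 <= n)%N \/ s = 0%N ->
  apolar_ideal (q ^+ s) = I s.+1.
Proof.
move=> hns; apply/seteqP; split=> p /=; last exact: ideal_harmonic_apolar.
(* For s = 0 the ideal of H_0 contains 1, so the same argument starts the
   induction. *)
elim: s hns p => [|s IHs] hns p Ap; apply: (expansion_apolar hns _ Ap);
  apply: (expansion_of_ideal hns).
  rewrite -[p]mulr1 -mpolyC1; apply: ideal_generated_mem.
  exact: harmonic_const.
have n2 : (2 <= n)%N by case: hns.
apply: IHs => /=; first by left.
have c0 : (0 < 2 * s.+1 * (n + 2 * s))%N.
  by rewrite !muln_gt0 addn_gt0 (ltnW n2).
apply: (scale_nat_inj c0).
rewrite scaler0 -apolar_actionZr -laplacian_quadricX -apolar_action_quadric.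
by rewrite -apolar_actionM mulrC apolar_actionM Ap apolar_action0r.
Qed.

End CharZero.

Theorem theorem3p8 (R : realType) (n s : nat) (hns : (2 <= n)%N \/ s = 0%N) :
  apolar_ideal (quadric R[i] n ^+ s) = ideal_generated (harmonic R[i] n s.+1).
Proof. by apply: apolar_ideal_quadricX hns; apply: Num.Theory.pchar_num. Qed.
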